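(* The pair correlation functions $\nu_{ij}$ of the hull $\mathbb{Y}$ satisfy, for all $z\in\mathbb{R}$, the linear renormalisation equations $$\nu_{00}(z)=\tfrac1\lambda\Bigl(\nu_{00}\bigl(\tfrac z\lambda\bigr)+\nu_{01}\bigl(\tfrac z\lambda\bigr)+\nu_{10}\bigl(\tfrac z\lambda\bigr)+\nu_{11}\bigl(\tfrac z\lambda\bigr)\Bigr),$$ $$\nu_{01}(z)=\tfrac1\lambda\sum_{m=0}^{2}\Bigl(\nu_{00}\bigl(\tfrac{z-m-\lambda}{\lambda}\bigr)+\nu_{10}\bigl(\tfrac{z-m-\lambda}{\lambda}\bigr)\Bigr),$$ $$\nu_{10}(z)=\tfrac1\lambda\sum_{m=0}^{2}\Bigl(\nu_{00}\bigl(\tfrac{z+m+\lambda}{\lambda}\bigr)+\nu_{01}\bigl(\tfrac{z+m+\lambda}{\lambda}\bigr)\Bigr),$$ $$\nu_{11}(z)=\tfrac1\lambda\Bigl(3\,\nu_{00}\bigl(\tfrac z\lambda\bigr)+2\,\nu_{00}\bigl(\tfrac{z+1}\lambda\bigr)+2\,\nu_{00}\bigl(\tfrac{z-1}\lambda\bigr)+\nu_{00}\bigl(\tfrac{z+2}\lambda\bigr)+\nu_{00}\bigl(\tfrac{z-2}\lambda\bigr)\Bigr),$$ together with $\nu_{ij}(z)=0$ for any $z\notin S_{ij}$ and the symmetry relations $\nu_{ji}(z)=\nu_{ij}(-z)$ for all $z\in\mathbb{R}$ and all $i,j\in\{0,1\}$.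
   Context: Let $\varrho$ be the substitution $0\mapsto 0111$, $1\mapsto 0$ on the alphabet $\{0,1\}$, with substitution matrix $M=\begin{pmatrix}1&1\\3&0\end{pmatrix}$ and Perron--Frobenius eigenvalue $\lambda=(1+\sqrt{13})/2$. Let $w\in\{0,1\}^{\mathbb{Z}}$ be the bi-infinite fixed point of $\varrho^2$ with seed $0|0$, i.e. the limit of $\varrho^{2n}(0)|\varrho^{2n}(0)$ as $n\to\infty$, where $|$ marks the place between positions $-1$ and $0$. Realise $w$ as a tiling of $\mathbb{R}$ by intervals, of length $\lambda$ for letter $0$ and length $1$ for letter $1$, with the marker $|$ placed at $0\in\mathbb{R}$, and let $\Lambda^w$ be the set of left endpoints of the intervals. The geometric hull $\mathbb{Y}$ is the closure of $\{t+\Lambda^w:t\in\mathbb{R}\}$ in the local topology (two sets are close if they agree on a large ball around $0$ up to a small translation). For $\Lambda\in\mathbb{Y}$, write $\Lambda=\Lambda^{(0)}\,\dot\cup\,\Lambda^{(1)}$, where $\Lambda^{(i)}$ is the set of left endpoints of intervals of type $i$ (a point is of type $0$, resp. $1$, if its distance to the next point on the right is $\lambda$, resp. $1$). Pair correlation functions: with $\Lambda_r=\Lambda\cap[-r,r]$ and $\Lambda^{(i)}_r=\Lambda^{(i)}\cap[-r,r]$, set $\nu_{ij}(z)=\lim_{r\to\infty}\frac{\mathrm{card}(\Lambda^{(i)}_r\cap(\Lambda^{(j)}_r-z))}{\mathrm{card}(\Lambda_r)}$ for $z\in\mathbb{R}$; these limits exist (by unique ergodicity of the hull under translation) and do not depend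 on $\Lambda\in\mathbb{Y}$. The set $S_{ij}=\Lambda^{(j)}-\Lambda^{(i)}=\{y-x: y\in\Lambda^{(j)},x\in\Lambda^{(i)}\}$ is also independent of $\Lambda\in\mathbb{Y}$. *)

(* Defs.v *)
From mathcomp Require Import all_boot all_order all_algebra finmap.
From mathcomp Require Import all_classical all_reals all_analysis.

Set Implicit Arguments.
Unset Strict Implicit.
Unset Printing Implicit Defensive.

Import Order.TTheory GRing.Theory Num.Theory.
Import numFieldNormedType.Exports.

Local Open Scope classical_set_scope.
Local Open Scope ring_scope.

Definition subst_letter (a : 'I_2) : seq 'I_2 :=
  if a == 0 then [:: 0; 1; 1; 1] else [:: 0].

Definition subst_word (u : seq 'I_2) : seq 'I_2 :=
  flatten (map subst_letter u).

(* The word obtained by applying the squared substitution n times to 0. *)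
Definition superword (n : nat) : seq 'I_2 := iter n.*2 subst_word [:: 0].

(* The limit of superword n | superword n, the marker sitting between the
   positions -1 and 0. Recall that Negz n is the integer -(n + 1); any
   iterate of length > n may be used to read off the letters at n and
   -(n + 1), see fixed_wordE and ltn_size_superword. *)
Definition fixed_word (k : int) : 'I_2 :=
  match k with
  | Posz n => nth 0 (superword n) n
  | Negz n => nth 0 (rev (superword n)) n
  end.

Lemma subst_word_cat u v : subst_word (u ++ v) = subst_word u ++ subst_word v.
Proof. by rewrite /subst_word map_cat flatten_cat. Qed.

Lemma iter_subst_word_cat n u v :
  iter n subst_word (u ++ v) = iter n subst_word u ++ iter n subst_word v.
Proof. by elim: n => //= n ->; rewrite subst_word_cat. Qed.

Lemma superwordS n : exists2 u, (0 < size u)%N &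
  superword n.+1 = superword n ++ u ++ superword n.
Proof.
exists (iter n.*2 subst_word [:: 1; 1; 1; 0; 0]).
  elim: n.*2 => //= m; case: (iter _ _ _) => //= a s _.
  by rewrite /subst_word /= size_cat /subst_letter; case: ifP.
rewrite /superword doubleS !iterSr -!iter_subst_word_cat; congr iter.
Qed.

Lemma ltn_size_superword n : (n < size (superword n))%N.
Proof.
elim: n => // n IHn; have [u u0 ->] := superwordS n; rewrite !size_cat.
by rewrite -addn1 leq_add // ltn_addr.
Qed.

Lemma superword_prefix m n : (m <= n)%N ->
  exists u, exists v, superword n = superword m ++ u /\
                      superword n = v ++ superword m.
Proof.
elim: n => [|n IHn]; first by rewrite leqn0 => /eqP ->; exists [::], [::]; rewrite cats0.
rewrite leq_eqVlt => /predU1P[->|]; first by exists [::], [::]; rewrite cats0.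
move=> /IHn[u [v [Eu Ev]]]; have [t _ E] := superwordS n.
exists (u ++ t ++ superword n), (superword n ++ t ++ v); split.
  by rewrite E {1}Eu -!catA.
by rewrite E {2}Ev -!catA.
Qed.

Lemma fixed_wordE m n : (n < size (superword m))%N ->
  fixed_word (Posz n) = nth 0 (superword m) n /\
  fixed_word (Negz n) = nth 0 (rev (superword m)) n.
Proof.
move=> nm; have nn := ltn_size_superword n; rewrite /fixed_word.
have [/superword_prefix[u [v [Eu Ev]]]|/ltnW/superword_prefix[u [v [Eu Ev]]]]
  := leqP m n.
  by split; [rewrite Eu | rewrite Ev rev_cat]; rewrite nth_cat ?size_rev nm.
by split; [rewrite Eu | rewrite Ev rev_cat]; rewrite nth_cat ?size_rev nn.
Qed.

Section Hull.
Context {R : realType}.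
Implicit Types (A B L : set R) (i j : 'I_2).

Definition lambda : R := (1 + Num.sqrt 13) / 2.

Definition tile_length i : R := if i == 0 then lambda else 1.

(* Left endpoint of the k-th interval of the tiling defined by the fixed word,
   the 0-th interval starting at the origin. *)
Definition endpoint (k : int) : R :=
  match k with
  | Posz n => \sum_(m < n) tile_length (fixed_word (Posz m))
  | Negz n => - \sum_(m < n.+1) tile_length (fixed_word (Negz m))
  end.

Definition Lambda_w : set R := range endpoint.

Definition translate (t : R) A : set R := [set t + x | x in A].

(* Agreement on the ball of radius 1 / e up to a translation of size <= e;
   these relations are the basic entourages of the local topology. *)
Definition locally_close (e : R) A B : Prop :=
  exists2 s : R, `|s| <= e &
    A `&` `[- e^-1, e^-1] = translate s B `&` `[- e^-1, e^-1].

(* Closure, in the local topology, of the translation orbit of Lambda_w. *)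
Definition hull : set (set R) :=
  [set L | forall e : R, 0 < e ->
             exists t : R, locally_close e L (translate t Lambda_w)].

(* The points of L whose next point on the right lies at distance
   tile_length i. *)
Definition points_of_type L i : set R :=
  [set x | [/\ L x, L (x + tile_length i) &
               forall y, L y -> x < y -> x + tile_length i <= y]].

Definition truncation A (r : R) : set R := A `&` `[- r, r].

(* The cardinality of a finite set of reals; all sets it is applied to below
   are finite when L belongs to the hull. *)
Definition card (A : set R) : nat := #|` fset_set A|.

Definition pair_ratio L i j (z r : R) : R :=
  (card (truncation (points_of_type L i) r `&`
         [set y - z | y in truncation (points_of_type L j) r]))%:R
  / (card (truncation L r))%:R.

Definition pair_corr L i j (z : R) : R :=
  lim (pair_ratio L i j z r @[r --> +oo]).

Definition difference_set L i j : set R :=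
  [set y - x | y in points_of_type L j & x in points_of_type L i].

End Hull.

(* Main.v *)
Require Import Defs.
From mathcomp Require Import all_boot all_order all_algebra finmap.
From mathcomp Require Import all_classical all_reals all_analysis.
From mathcomp Require Import zify ring lra.

Import Order.TTheory GRing.Theory Num.Theory.
Import numFieldNormedType.Exports.

Local Open Scope classical_set_scope.
Local Open Scope ring_scope.

(** Everything reduces to counting in finite words. A word [u] is read as a
    patch of tiles, and [paircount i j z u] is the number of pairs of tiles of
    types [i] and [j] in that patch whose left endpoints differ by [z].

    _Densities exist._ Cutting a patch in two destroys at most [|z|] pairs,
    because tiles have length at least 1 ([paircount_cat]); so the count is
    superadditive with a bounded defect. For the patches of the iterates of
    the letter 0, whose lengths are the powers of [lambda], write [x n] for
    the count per unit length. As the iterate of level [n + 2] is that of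
    level [n + 1] followed by three copies of that of level [n],
    superadditivity gives [x (n + 2) >= x (n + 1) / lambda + q * x n] with
    [q = 3 / lambda ^ 2], and the weights [1 / lambda] and [q] add up to 1
    because [lambda ^ 2 = lambda + 3]. Hence [x (n + 1) + q * x n] is
    nondecreasing and bounded, and since [q < 1] its convergence forces that
    of [x] ([scaled_count_cvg]). A long factor of a word obtained by [n]
    substitutions is, up to two short ends, a concatenation of level-[n]
    blocks, so its count per unit length is uniformly close to the limit
    ([uniform_density]).

    _Densities are the correlations._ Every element of the hull looks, inside
    [[- r, r]], like the patch of a factor of the fixed word ([hull_patch]).
    The ratio defining the correlation is therefore the pair count of this
    patch over its number of tiles, and the latter is itself a sum of pair
    counts at distance 0. So the limit is a quotient of two densities which
    only depend on the substitution ([pair_ratio_cvg]).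

    _Renormalisation._ In the patch of the substituted word, the tiles of type
    0 start exactly at the points [lambda * y], for [y] the start of any tile
    of the original patch, and those of type 1 at [lambda * y + lambda + m],
    for [y] the start of a tile of type 0 and [m < 3]. Counting pairs gives
    the four equations as exact identities between word counts
    ([paircount00_subst] to [paircount11_subst]); applying the
    substitution once more multiplies lengths by [lambda], whence the factor
    [1 / lambda]. The symmetry is that of the count, and no pair is ever
    counted at a distance outside the difference set. *)

(** * Words as patches of tiles *)

Section Words.
Context {R : realType}.
Implicit Types (x y z : R) (i j a : 'I_2) (u v : seq 'I_2).

Local Notation lam := (@lambda R).
Local Notation len := (@tile_length R).

Lemma ltr2_lambda : 2 < lam.
Proof.
have : Num.sqrt (3 ^+ 2) < Num.sqrt 13 :> R by rewrite ltr_sqrt //; lra.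
rewrite sqrtr_sqr ger0_norm // => ?.
by rewrite /lambda; lra.
Qed.

Lemma lambda_gt0 : 0 < lam.
Proof. by have := ltr2_lambda; lra. Qed.

Lemma lambda_sqr : lam ^+ 2 = lam + 3.
Proof.
have h : Num.sqrt 13 ^+ 2 = 13 :> R by rewrite sqr_sqrtr.
rewrite /lambda; move: h; set s := Num.sqrt _ => h.
have -> : ((1 + s) / 2) ^+ 2 = (1 + s + s + s ^+ 2) / 4 by field.
by rewrite h; field.
Qed.

Lemma tile_length_bounds a : 1 <= len a <= lam.
Proof. by have := ltr2_lambda; rewrite /tile_length; case: ifP => _; lra. Qed.

Lemma letterP a : {a = 0} + {a = 1}.
Proof. by case: a => [[|[|?]] //= ?]; [left|right]; apply/val_inj. Qed.

Lemma tile_length_inj i j : len i = len j -> i = j.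
Proof.
have := ltr2_lambda; rewrite /tile_length.
by case: (letterP i) (letterP j) => [->|->] [->|->] //= ? ?; exfalso; lra.
Qed.

Definition word_length u : R := \sum_(a <- u) len a.

Lemma word_length_cons a u : word_length (a :: u) = len a + word_length u.
Proof. by rewrite /word_length big_cons. Qed.

Lemma word_length_cat u v : word_length (u ++ v) = word_length u + word_length v.
Proof. by rewrite /word_length big_cat. Qed.

Lemma size_le_word_length u : (size u)%:R <= word_length u.
Proof.
elim: u => [|a u IH]; first by rewrite /word_length big_nil.
by rewrite word_length_cons /= -natr1; have := tile_length_bounds a; lra.
Qed.

Lemma word_length_le_size u : word_length u <= lam * (size u)%:R.
Proof.
elim: u => [|a u IH]; first by rewrite /word_length big_nil mulr0.
by rewrite word_length_cons /= -natr1 mulrDr mulr1; have := tile_length_bounds a; lra.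
Qed.

Lemma word_length_ge0 u : 0 <= word_length u.
Proof. exact: le_trans (size_le_word_length u). Qed.

(** The tile lengths form a left eigenvector of the substitution matrix: this
    is what [lambda ^ 2 = lambda + 3] says on the letter 0. *)
Lemma word_length_subst u : word_length (subst_word u) = lam * word_length u.
Proof.
elim: u => [|a u IH]; first by rewrite /word_length !big_nil mulr0.
rewrite (word_length_cat (subst_letter a)) IH word_length_cons mulrDr; congr (_ + _).
rewrite /subst_letter /tile_length /word_length; case: ifP => _.
  rewrite !big_cons big_nil /tile_length /= -expr2 lambda_sqr; lra.
by rewrite big_seq1 /tile_length /= mulr1.
Qed.

Lemma word_length_iter n u :
  word_length (iter n subst_word u) = lam ^+ n * word_length u.
Proof.
elim: n => [|n IH]; first by rewrite mul1r.
by rewrite iterS word_length_subst IH exprS mulrA.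
Qed.

(** The patch of [u] starting at [x]: left endpoints paired with types. *)
Fixpoint tiles x u : seq (R * 'I_2) :=
  if u is a :: v then (x, a) :: tiles (x + len a) v else [::].

Lemma tiles_cat x u v :
  tiles x (u ++ v) = tiles x u ++ tiles (x + word_length u) v.
Proof.
elim: u x => [|a u IH] x /=; first by rewrite /word_length big_nil addr0.
by rewrite IH word_length_cons addrA.
Qed.

Lemma size_tiles x u : size (tiles x u) = size u.
Proof. by elim: u x => //= a u IH x; rewrite IH. Qed.

Lemma tiles_bounds x u p : p \in tiles x u ->
  x <= p.1 /\ p.1 + len p.2 <= x + word_length u.
Proof.
elim: u x => //= a u IH x; rewrite word_length_cons inE.
have h := tile_length_bounds a; have h2 := word_length_ge0 u.
by case/orP => [/eqP ->/=|/IH]; [split|case; split]; lra.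
Qed.

Lemma tiles_shift c x u : tiles (c + x) u = [seq (c + p.1, p.2) | p <- tiles x u].
Proof. by elim: u x => //= a u IH x; rewrite -addrA IH. Qed.

Lemma uniq_tile_starts x u : uniq [seq p.1 | p <- tiles x u].
Proof.
elim: u x => //= a u IH x; rewrite IH andbT; apply/negP => /mapP[p /tiles_bounds[]].
by move=> h _ e; have := tile_length_bounds a; lra.
Qed.

Lemma tile_successor x u y a : (y, a) \in tiles x u ->
  y + len a = x + word_length u \/ y + len a \in [seq p.1 | p <- tiles x u].
Proof.
elim: u x => //= b u IH x; rewrite inE => /orP[/eqP[-> ->]|/IH].
  case: u {IH} => [|c u]; first by left; rewrite word_length_cons /word_length big_nil addr0.
  by right; rewrite /= !inE eqxx orbT.
rewrite word_length_cons addrA => -[|h]; [by left|right].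
by rewrite inE h orbT.
Qed.

Lemma tile_interior x u y a p : (y, a) \in tiles x u -> p \in tiles x u ->
  y < p.1 -> y + len a <= p.1.
Proof.
elim: u x => //= b u IH x; rewrite !inE => /orP[/eqP[-> ->]|ya] /orP[/eqP ->|pu] /=.
- by rewrite ltxx.
- by move=> _; case: (tiles_bounds _ _ _ pu).
- by case: (tiles_bounds _ _ _ ya) => /= h _; have := tile_length_bounds b; lra.
- exact: (IH _ ya pu).
Qed.

Definition starts i x u : seq R := [seq p.1 | p <- tiles x u & p.2 == i].

Lemma mem_starts i x u y : (y \in starts i x u) = ((y, i) \in tiles x u).
Proof.
apply/mapP/idP => [[[y' i']]|h].
  by rewrite mem_filter => /andP[/= /eqP -> h ->].
by exists (y, i) => //; rewrite mem_filter eqxx.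
Qed.

Lemma uniq_starts i x u : uniq (starts i x u).
Proof. exact: subseq_uniq (map_subseq _ (filter_subseq _ _)) (uniq_tile_starts x u). Qed.

Lemma starts_cat i x u v :
  starts i x (u ++ v) = starts i x u ++ starts i (x + word_length u) v.
Proof. by rewrite /starts tiles_cat filter_cat map_cat. Qed.

Lemma starts_shift i c x u : starts i (c + x) u = [seq c + y | y <- starts i x u].
Proof. by rewrite /starts tiles_shift filter_map -!map_comp. Qed.

Lemma starts_bounds i x u y : y \in starts i x u -> x <= y < x + word_length u.
Proof.
rewrite mem_starts => /tiles_bounds[/= h1 h2].
by have := tile_length_bounds i; lra.
Qed.

Lemma size_starts i x u : (size (starts i x u) <= size u)%N.
Proof.
by rewrite size_map size_filter (leq_trans (count_size _ _)) ?size_tiles.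
Qed.

(** Distinct tiles start at least 1 apart, so no more than [t] of them start
    within the last [t] units of a patch. *)
Lemma count_starts_ge i x u y :
  (count (>= y) (starts i x u))%:R <= Num.max 0 (x + word_length u - y).
Proof.
have [xy|xy] := leP y x.
  rewrite le_max; apply/orP; right.
  have h1 := size_le_word_length u.
  have : (count (>= y) (starts i x u))%:R <= (size u)%:R :> R.
    by rewrite ler_nat (leq_trans (count_size _ _)) ?size_starts.
  lra.
elim: u x xy => [|a u IH] x xy; first by rewrite /= le_max lexx.
have -> : count (>= y) (starts i x (a :: u)) =
          count (>= y) (starts i (x + len a) u).
  by rewrite /starts /=; case: ifP => //= _; rewrite leNgt xy.
rewrite word_length_cons addrA.
have [xy'|] := ltP (x + len a) y; first exact: IH.
move=> xy'; rewrite le_max; apply/orP; right.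
have h1 := size_le_word_length u.
have : (count (>= y) (starts i (x + len a) u))%:R <= (size u)%:R :> R.
  by rewrite ler_nat (leq_trans (count_size _ _)) ?size_starts.
lra.
Qed.

(** The form as a double sum is symmetric in the two lists and lets the
    substitution act on each of them separately; [pairs_atE] gives the form
    as a cardinal. *)
Definition pairs_at (s t : seq R) z : nat :=
  (\sum_(x <- s) \sum_(y <- t) (y - x == z)%R)%N.

Lemma pairs_atE s t z : uniq t ->
  pairs_at s t z = count (fun x => x + z \in t) s.
Proof.
move=> ut; rewrite /pairs_at -sum1_count [RHS]big_mkcond /=; apply: eq_bigr => x _.
under eq_bigr => y _ do rewrite subr_eq addrC.
by rewrite -big_mkcond /= sum1_count -[count _ _]/(count_mem (x + z) t) count_uniq_mem //; case: (_ \in _).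
Qed.

Lemma pairs_at_sym s t z : pairs_at t s (- z) = pairs_at s t z.
Proof.
rewrite /pairs_at exchange_big; apply: eq_bigr => x _; apply: eq_bigr => y _.
by rewrite -eqr_opp opprB opprK.
Qed.

Lemma pairs_at_catl s1 s2 t z :
  pairs_at (s1 ++ s2) t z = (pairs_at s1 t z + pairs_at s2 t z)%N.
Proof. by rewrite /pairs_at big_cat. Qed.

Lemma pairs_at_catr s t1 t2 z :
  pairs_at s (t1 ++ t2) z = (pairs_at s t1 z + pairs_at s t2 z)%N.
Proof. by rewrite /pairs_at -big_split; apply: eq_bigr => x _; rewrite big_cat. Qed.

Lemma pairs_at_shift c s t z :
  pairs_at [seq c + x | x <- s] [seq c + x | x <- t] z = pairs_at s t z.
Proof.
rewrite /pairs_at big_map; apply: eq_bigr => x _; rewrite big_map.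
by apply: eq_bigr => y _; rewrite opprD addrACA subrr add0r.
Qed.

Definition paircount i j z u : nat := pairs_at (starts i 0 u) (starts j 0 u) z.

(** Only differences of positions matter, so the origin of the patch does
    not. *)
Lemma paircountE i j z x u :
  pairs_at (starts i x u) (starts j x u) z = paircount i j z u.
Proof. by rewrite -[x]addr0 !starts_shift pairs_at_shift. Qed.

Lemma paircount_sym i j z u : paircount j i (- z) u = paircount i j z u.
Proof. exact: pairs_at_sym. Qed.

Lemma paircount_le_length i j z u : (paircount i j z u)%:R <= word_length u.
Proof.
apply: le_trans (size_le_word_length u); rewrite ler_nat.
by rewrite /paircount pairs_atE ?uniq_starts // (leq_trans (count_size _ _)) ?size_starts.
Qed.

(** A tile of the left patch forming a pair with one of the right patch
    starts within [z] of the cut, and it determines its partner. *)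
Lemma cross_pairs_le i j z x u v :
  (pairs_at (starts i x u) (starts j (x + word_length u) v) z)%:R <= Num.max 0 z.
Proof.
have -> : Num.max 0 z = Num.max 0 (x + word_length u - (x + word_length u - z)).
  by congr Num.max; rewrite opprB addrC subrK.
apply: le_trans (count_starts_ge i _ _ _).
rewrite ler_nat pairs_atE ?uniq_starts //; apply: sub_count => y /=.
by move=> /starts_bounds; lra.
Qed.

(** At most one of the two cross terms, counted from left to right with
    [z] and from right to left with [- z], is nonzero. *)
Lemma paircount_cat i j z u v :
  (paircount i j z u)%:R + (paircount i j z v)%:R <= (paircount i j z (u ++ v))%:R :> R
  /\ (paircount i j z (u ++ v))%:R <=
     (paircount i j z u)%:R + (paircount i j z v)%:R + `|z|.
Proof.
have -> : paircount i j z (u ++ v) =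
  (paircount i j z u + paircount i j z v +
  (pairs_at (starts i 0 u) (starts j (0 + word_length u) v) z +
   pairs_at (starts j 0 u) (starts i (0 + word_length u) v) (- z)))%N.
  rewrite {1}/paircount !starts_cat pairs_at_catl !pairs_at_catr !paircountE.
  by rewrite [pairs_at (starts j 0 u) _ _]pairs_at_sym [X in (_ + X)%N]addnC addnACA.
have h1 := cross_pairs_le i j z 0 u v; have h2 := cross_pairs_le j i (- z) 0 u v.
rewrite !natrD; split; first by rewrite lerDl addr_ge0.
rewrite lerD2l; apply: le_trans (lerD h1 h2) _.
have [z0|z0] := leP 0 z; first by rewrite (max_idPl _) ?oppr_le0 // addr0 ger0_norm.
by rewrite (max_idPr _) ?oppr_ge0 ?(ltW z0) // add0r ltr0_norm.
Qed.

(** Pairs at distance 0 are single tiles; this makes the denominator of the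
    correlation ratio one more instance of a pair count. *)
Lemma size_paircount u :
  (size u = paircount 0%R 0%R 0%R u + paircount 1%R 1%R 0%R u)%N.
Proof.
have E i : paircount i i 0 u = count (pred1 i) u.
  rewrite /paircount pairs_atE ?uniq_starts //.
  have /eq_in_count -> : {in starts i 0 u, (fun x => x + 0 \in starts i 0 u) =1 predT}.
    by move=> x hx; rewrite addr0 hx.
  rewrite count_predT /starts size_map size_filter.
  by elim: u 0 => //= a u IH x; rewrite IH.
rewrite !E -(count_predC (pred1 0)); congr addn.
by apply: eq_count => -[[|[|?]] //= ?].
Qed.

End Words.

(* Numerals in these arguments are letters or real numbers, even inside an
   identity between natural numbers. *)
Arguments starts {R} (i x)%_R u.
Arguments pairs_at {R} s t z%_R.
Arguments paircount {R} (i j z)%_R u.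

(** * Pair counts of a substituted word *)

Section Renormalisation.
Context {R : realType}.
Implicit Types (x y z : R) (i j a : 'I_2) (u v : seq 'I_2).
Local Notation lam := (@lambda R).

Lemma word_length_subst_letter a : word_length (subst_letter a) = lam * tile_length a.
Proof.
have := @word_length_subst R [:: a]; rewrite /subst_word /= cats0 => ->.
by rewrite /word_length big_seq1.
Qed.

(** Each letter has exactly one 0 in its image, at the start: tiles of type 0
    of the substituted patch are the inflated starts of all tiles. *)
Lemma big_starts0_subst (F : R -> nat) x u :
  (\sum_(y <- starts 0%R (lam * x)%R (subst_word u)) F y =
   \sum_(y <- starts 0%R x u) F (lam * y)%R + \sum_(y <- starts 1%R x u) F (lam * y)%R)%N.
Proof.
elim: u x => [|a u IH] x; first by rewrite !big_nil.
rewrite -[subst_word _]/(subst_letter a ++ subst_word u) starts_cat big_cat.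
rewrite word_length_subst_letter -mulrDr IH /=; case: (letterP a) => ->.
  by rewrite /starts /= !big_cons big_nil /= addn0 addnA.
by rewrite /starts /= !big_cons big_nil /= addn0 addnCA.
Qed.

(** Letters 1 only come from the image 0111 of a 0, after its tile of length
    [lambda]. *)
Lemma big_starts1_subst (F : R -> nat) x u :
  (\sum_(y <- starts 1%R (lam * x)%R (subst_word u)) F y =
   \sum_(0 <= m < 3) \sum_(y <- starts 0%R x u) F (lam * y + lam + m%:R)%R)%N.
Proof.
rewrite exchange_big /=.
elim: u x => [|a u IH] x; first by rewrite !big_nil.
rewrite -[subst_word _]/(subst_letter a ++ subst_word u) starts_cat big_cat.
rewrite word_length_subst_letter -mulrDr IH /=; case: (letterP a) => ->.
  rewrite /starts /= !big_cons !big_nil /=.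
  by rewrite addr0 -[_ + 1 + 1]addrA.
by rewrite /starts /= big_nil.
Qed.

(** The offset [d] is the difference of the places of the two tiles inside
    the images they belong to. *)
Lemma pairs_at_scale (s t : seq R) z d :
  (\sum_(x <- s) \sum_(y <- t) ((lam * y - lam * x + d)%R == z) =
   pairs_at s t ((z - d) / lam))%N.
Proof.
apply: eq_bigr => x _; apply: eq_bigr => y _; congr nat_of_bool.
rewrite -mulrBr -[RHS](inj_eq (mulfI (lt0r_neq0 lambda_gt0))) mulrCA divff ?mulr1.
  by rewrite [RHS]eq_sym subr_eq eq_sym.
exact: lt0r_neq0 lambda_gt0.
Qed.

Lemma paircount00_subst z u :
  paircount 0 0 z (subst_word u) =
  (paircount 0 0 (z / lam)%R u + paircount 0 1 (z / lam)%R u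
   + paircount 1 0 (z / lam)%R u + paircount 1 1 (z / lam)%R u)%N.
Proof.
rewrite {1}/paircount /pairs_at -[in LHS](mulr0 lam) big_starts0_subst.
under eq_bigr do rewrite big_starts0_subst.
under [X in (_ + X)%N]eq_bigr do rewrite big_starts0_subst.
rewrite !big_split /= !addnA.
by rewrite /paircount -[z in RHS]subr0 -!pairs_at_scale;
   do 3?congr addn; apply: eq_bigr => x _; apply: eq_bigr => y _; rewrite addr0.
Qed.

Lemma paircount01_subst z u :
  paircount 0 1 z (subst_word u) =
  (\sum_(0 <= m < 3) (paircount 0 0 ((z - m%:R - lam) / lam)%R u
                    + paircount 1 0 ((z - m%:R - lam) / lam)%R u))%N.
Proof.
rewrite {1}/paircount /pairs_at -[in LHS](mulr0 lam) big_starts0_subst.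
under eq_bigr do rewrite big_starts1_subst.
under [X in (_ + X)%N]eq_bigr do rewrite big_starts1_subst.
rewrite exchange_big [X in (_ + X)%N = _]exchange_big -big_split.
apply: eq_bigr => m _; rewrite -addrA -opprD.
rewrite /paircount -!pairs_at_scale.
by congr addn; apply: eq_bigr => x _; apply: eq_bigr => y _; congr (nat_of_bool (_ == _)); ring.
Qed.

(** The mirror image of [paircount01_subst]. *)
Lemma paircount10_subst z u :
  paircount 1 0 z (subst_word u) =
  (\sum_(0 <= m < 3) (paircount 0 0 ((z + m%:R + lam) / lam)%R u
                    + paircount 0 1 ((z + m%:R + lam) / lam)%R u))%N.
Proof.
rewrite -paircount_sym paircount01_subst; apply: eq_bigr => m _.
by rewrite -!opprD mulNr !paircount_sym.
Qed.

(** The coefficients 1, 2, 3, 2, 1 count the pairs of places in 0111 with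
    difference 2, 1, 0, -1, -2. *)
Lemma paircount11_subst z u :
  paircount 1 1 z (subst_word u) =
  (3 * paircount 0 0 (z / lam)%R u + 2 * paircount 0 0 ((z + 1) / lam)%R u
   + 2 * paircount 0 0 ((z - 1) / lam)%R u + paircount 0 0 ((z + 2) / lam)%R u
   + paircount 0 0 ((z - 2) / lam)%R u)%N.
Proof.
rewrite {1}/paircount /pairs_at -[in LHS](mulr0 lam) big_starts1_subst.
under eq_bigr do under eq_bigr do rewrite big_starts1_subst.
have -> : (\sum_(0 <= i0 < 3) \sum_(i <- starts 0%R 0%R u) \sum_(0 <= m < 3)
    \sum_(y <- starts 0%R 0%R u) ((lam * y + lam + m%:R - (lam * i + lam + i0%:R))%R == z) =
   \sum_(0 <= k < 3) \sum_(0 <= m < 3) paircount 0%R 0%R ((z - (m%:R - k%:R)) / lam)%R u)%N.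
  apply: eq_bigr => k _; rewrite exchange_big; apply: eq_bigr => m _.
  rewrite /paircount -pairs_at_scale; apply: eq_bigr => x _; apply: eq_bigr => y _.
  by congr (nat_of_bool (_ == _)); ring.
rewrite !big_nat_recr //= !big_nil !add0n.
have E (c d : R) : c = d -> paircount 0 0 (c / lam) u = paircount 0 0 (d / lam) u by move->.
rewrite !(E (z - (0%:R - 0%:R)) z, E (z - (1%:R - 1%:R)) z, E (z - (2%:R - 2%:R)) z,
  E (z - (0%:R - 1%:R)) (z + 1), E (z - (1%:R - 2%:R)) (z + 1), E (z - (0%:R - 2%:R)) (z + 2),
  E (z - (1%:R - 0%:R)) (z - 1), E (z - (2%:R - 1%:R)) (z - 1), E (z - (2%:R - 0%:R)) (z - 2)).
all: ring.
Qed.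

End Renormalisation.

(** * Densities of almost additive counts *)

Lemma prefix_cat_cases (T : eqType) (u b w : seq T) : prefix u (b ++ w) ->
  prefix u b \/ exists2 u', u = b ++ u' & prefix u' w.
Proof.
elim: b u => [|c b IH] u; first by right; exists u.
case: u => [|d u] /=; first by left.
case/andP=> /eqP -> /IH[h|[u' -> h]]; first by left; rewrite eqxx.
by right; exists u'.
Qed.

(** A factor of a concatenation lies in one of the two words or straddles
    the cut. *)
Lemma infix_cat_cases (T : eqType) (u b w : seq T) : infix u (b ++ w) ->
  [\/ infix u b, infix u w |
     exists s p, [/\ u = s ++ p, suffix s b & prefix p w]].
Proof.
elim: b => [|c b IH]; first by constructor 2.
rewrite [infix _ _]/(prefix u ((c :: b) ++ w) || infix u (b ++ w)) => /orP[|/IH[h|h|[s [p [-> h1 h2]]]]].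
- move=> /prefix_cat_cases[h|[p -> h]].
    by constructor 1; apply: prefixW.
  by constructor 3; exists (c :: b), p; rewrite suffix_refl.
- by constructor 1; apply/orP; right.
- by constructor 2.
- by constructor 3; exists s, p; split=> //; apply: (suffix_catr [:: c]).
Qed.

Section Density.
Context {R : realType}.
Implicit Types (C q eps : R) (u v : seq 'I_2) (F : seq 'I_2 -> R).
Local Notation lam := (@lambda R).

(** The fixed point [c] of the limiting recursion [c = l - q * c] attracts,
    since the error is multiplied by [- q] at each step, up to a term tending
    to 0. *)
Lemma alternating_contraction_cvg (h e : R ^nat) q (l : R) : 0 <= q < 1 ->
  (forall n, h n.+1 = e n - q * h n) ->
  e n @[n --> \oo] --> l -> h n @[n --> \oo] --> l / (1 + q).
Proof.
move=> /andP[q0 q1] rec cve.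
set c := l / (1 + q); have cE : c = l - q * c by rewrite /c; field; lra.
apply/cvgrPdist_le => eps eps0.
have d0 : 0 < (1 - q) * (eps / 2) by rewrite mulr_gt0 //; lra.
move/cvgrPdist_le: cve => /(_ _ d0)[N _ eN].
have bound k : `|c - h (N + k)%N| <= q ^+ k * `|c - h N| + eps / 2.
  elim: k => [|k IH]; first by rewrite addn0 mul1r; lra.
  have -> : c - h (N + k.+1)%N = (l - e (N + k)%N) - q * (c - h (N + k)%N).
    by rewrite addnS rec {1}cE; ring.
  apply: le_trans (ler_normB _ _) _; rewrite normrM (ger0_norm q0) exprS -mulrA.
  have := eN (N + k)%N (leq_addr _ _); have := ler_wpM2l q0 IH; rewrite mulrDr /=.
  lra.
have [K _ qK] : \forall k \near \oo, q ^+ k * `|c - h N| <= eps / 2.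
  have : q ^+ k * `|c - h N| @[k --> \oo] --> (0 : R).
    by rewrite -[0](mul0r `|c - h N|); apply: cvgMl; apply: cvg_expr; rewrite ger0_norm.
  move/cvgrPdist_le => /(_ (eps / 2)) []; first by lra.
  move=> K _ hK; exists K => // k Kk; have := hK k Kk.
  by rewrite /= sub0r normrN ger0_norm // mulr_ge0 // exprn_ge0.
exists (N + K)%N => // n; rewrite /= => NKn.
have -> : n = (N + (n - N))%N by lia.
have := bound (n - N)%N; have := qK (n - N)%N; rewrite /=.
have -> : (K <= n - N)%N by lia.
by move=> /(_ isT); lra.
Qed.

(** The count [F] is at most one per unit of length, and at most [C] is
    gained when two patches are glued. *)
Definition almost_additive C F : Prop :=
  (forall u, 0 <= F u <= word_length u) /\
  (forall u v, F u + F v <= F (u ++ v) <= F u + F v + C).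

(** The word has length [lam ^+ n.+1], so this is a count per unit length. *)
Definition scaled_count F n : R := F (iter n subst_word [:: 0]) / lam ^+ n.+1.

Lemma iter_subst_nil n : iter n subst_word [::] = [::].
Proof. by elim: n => //= n ->. Qed.

Lemma iter_subst_one n : iter n.+1 subst_word [:: 1] = iter n subst_word [:: 0].
Proof. by rewrite iterSr. Qed.

(** The image 0111 of 0, read [n + 1] levels up; each of its letters 1 is one
    level behind. *)
Lemma iter_subst_zero_rec n : iter n.+2 subst_word [:: 0] =
  iter n.+1 subst_word [:: 0] ++ iter n subst_word [:: 0] ++
  iter n subst_word [:: 0] ++ iter n subst_word [:: 0].
Proof. by rewrite iterSr -!(iter_subst_one n) -!iter_subst_word_cat. Qed.

(** With [q = 3 / lam ^+ 2], superadditivity makes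
    [x n.+1 + q * x n] nondecreasing, and convergence of this combination
    implies that of [x]. *)
Lemma scaled_count_cvg C F : almost_additive C F ->
  cvgn (scaled_count F).
Proof.
move=> [F01 Fadd]; have lam0 := @lambda_gt0 R; have lam2 := @ltr2_lambda R.
have lamsq := @lambda_sqr R.
have lamn0 : lam != 0 by rewrite gt_eqF.
set x := scaled_count F; pose q := 3 / lam ^+ 2.
have q01 : 0 <= q < 1.
  rewrite /q divr_ge0 ?exprn_ge0 ?(ltW lam0) //= ltr_pdivrMr ?exprn_gt0 // mul1r; lra.
pose s n := x n.+1 + q * x n.
have lenE n : word_length (iter n subst_word [:: 0]) = lam ^+ n.+1.
  by rewrite word_length_iter /word_length big_seq1 /tile_length /= exprSr.
have x01 n : 0 <= x n <= 1.
  have /andP[f0 f1] := F01 (iter n subst_word [:: 0]).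
  rewrite /x /scaled_count divr_ge0 ?exprn_ge0 ?(ltW lam0) //=.
  by rewrite ler_pdivrMr ?exprn_gt0 // mul1r -lenE.
have s_incr : nondecreasing_seq s.
  apply/nondecreasing_seqP => n; rewrite /s.
  suff : x n.+1 / lam + q * x n <= x n.+2.
    have -> : lam^-1 = 1 - q.
      by apply: (mulfI (expf_neq0 2 lamn0)); rewrite /q; field: lamsq.
    lra.
  rewrite /x /scaled_count iter_subst_zero_rec.
  have := Fadd (iter n.+1 subst_word [:: 0]) (iter n subst_word [:: 0] ++
    iter n subst_word [:: 0] ++ iter n subst_word [:: 0]).
  have := Fadd (iter n subst_word [:: 0]) (iter n subst_word [:: 0] ++ iter n subst_word [:: 0]).
  have := Fadd (iter n subst_word [:: 0]) (iter n subst_word [:: 0]).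
  move=> /andP[h1 _] /andP[h2 _] /andP[h3 _].
  rewrite ler_pdivlMr ?exprn_gt0 //; apply: le_trans h3.
  set A := F (iter n.+1 _ _); set B := F (iter n _ _) in h1 h2 *.
  have -> : (A / lam ^+ n.+2 / lam + q * (B / lam ^+ n.+1)) * lam ^+ n.+3 = A + 3 * B.
    by rewrite /q !exprS; field; rewrite lamn0 expf_neq0.
  lra.
have s_cvg : cvgn s.
  apply: nondecreasing_is_cvgn => //; exists (1 + q) => _ [n _ <-].
  rewrite /s; have /andP[_ h1] := x01 n.+1; have /andP[_ h2] := x01 n.
  have /andP[q0 _] := q01; have := ler_wpM2l q0 h2; lra.
apply/cvg_ex; exists (limn s / (1 + q)).
apply: (@alternating_contraction_cvg x s) => //.
by move=> n; rewrite /s addrK.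
Qed.

Lemma natr_le_lambdaX n : n%:R <= lam ^+ n.
Proof.
have := @ltr2_lambda R => h.
suff : n%:R + 1 <= lam ^+ n by lra.
elim: n => [|n IH]; first by rewrite add0r.
rewrite exprS -natr1; have : 2 * lam ^+ n <= lam * lam ^+ n.
  by apply: ler_wpM2r; rewrite ?exprn_ge0 //; lra.
have : 0 <= n%:R :> R by [].
lra.
Qed.

(** At a level [n] where the density of each block is within [eps / 2] of the
    limit and the gluing defect [C] is at most [eps / 2] times the length of
    a block, gluing blocks one by one keeps the error below [eps] times the
    length. The constant [K] accounts for the incomplete blocks at both ends
    and for one more cut. *)
Lemma uniform_density C F eps : almost_additive C F -> 0 < eps ->
  exists n K, forall v u, infix u (iter n subst_word v) ->
    `|F u - limn (scaled_count F) * word_length u| <= eps * word_length u + K.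
Proof.
move=> FC eps0; have := scaled_count_cvg _ _ FC; have [F01 Fadd] := FC.
have lam0 := @lambda_gt0 R; have lam2 := @ltr2_lambda R.
set D := limn _ => cvD.
have C0 : 0 <= C.
  by have /andP[h1 h2] := Fadd [::] [::]; lra.
move/cvgrPdist_le: (cvD) => /(_ (eps / 2)) []; first by lra.
move=> N _ hN.
(* One more than N, because a letter 1 is one level behind a letter 0. *)
pose n := (maxn N (Num.truncn (C / (eps / 2))).+1).+1.
have Cn : C <= eps / 2 * lam ^+ n.
  have h := natr_le_lambdaX n.
  have h2 : C / (eps / 2) <= n%:R.
    apply: le_trans (ltW (truncnS_gt _)) _; by rewrite ler_nat /n leqW // leq_maxr.
  rewrite ler_pdivrMr in h2; last lra.
  rewrite mulrC; apply: le_trans h2 _; apply: ler_wpM2r => //; lra.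
pose blk a := iter n subst_word [:: a].
have blk_len a : lam ^+ n <= word_length (blk a) <= lam ^+ n.+1.
  rewrite word_length_iter /word_length big_seq1.
  have /andP[h1 h2] := @tile_length_bounds R a.
  by rewrite exprSr ler_peMr ?exprn_ge0 ?(ltW lam0) //= ler_wpM2l // exprn_ge0 // ltW.
have blk_dens a : `|F (blk a) - D * word_length (blk a)| <= eps / 2 * word_length (blk a).
  have key m : (N <= m)%N ->
    `|F (iter m subst_word [:: 0]) - D * word_length (iter m subst_word [:: 0])|
     <= eps / 2 * word_length (iter m subst_word [:: 0]).
    move=> /hN /=; rewrite /scaled_count.
    rewrite word_length_iter /word_length big_seq1 /tile_length /= -exprSr.
    have Lm : 0 < lam ^+ m.+1 by rewrite exprn_gt0.
    move: (F _) (lam ^+ m.+1) Lm => f L L0.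
    have -> : f - D * L = - ((D - f / L) * L) by field; rewrite gt_eqF.
    by rewrite normrN normrM (gtr0_norm L0) ler_pM2r.
  case: (letterP a) => ->; rewrite /blk.
    by apply: key; rewrite /n; lia.
  by rewrite /n iter_subst_one; apply: key; lia.
pose K := (1 + `|D|) * lam ^+ n.+1.
have small u : word_length u <= lam ^+ n.+1 -> `|F u - D * word_length u| <= K.
  move=> hu; have /andP[f0 f1] := F01 u; have u0 := @word_length_ge0 R u.
  apply: le_trans (ler_normB _ _) _; rewrite normrM (ger0_norm f0) (ger0_norm u0) /K mulrDl mul1r.
  by rewrite lerD ?ler_wpM2l // (le_trans f1).
have K0 : 0 <= K by apply: le_trans (small [::] _) => //; rewrite /word_length big_nil exprn_ge0 // ltW.
have small_infix a u : infix u (blk a) -> `|F u - D * word_length u| <= eps * word_length u + K.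
  move=> /infixP[s [p bE]]; have : word_length u <= lam ^+ n.+1.
    have /andP[_] := blk_len a; rewrite bE !word_length_cat.
    have := @word_length_ge0 R s; have := @word_length_ge0 R p; lra.
  by move/small; have := mulr_ge0 (ltW eps0) (@word_length_ge0 R u); lra.
(* The block itself uses up half of its allowance [eps * length]; the other
   half absorbs the defect of gluing. *)
have step a u k : `|F u - D * word_length u| <= eps * word_length u + k ->
    `|F (blk a ++ u) - D * word_length (blk a ++ u)| <= eps * word_length (blk a ++ u) + k.
  move=> hu; rewrite word_length_cat !mulrDr.
  have := blk_dens a; have /andP[h1 h2] := blk_len a; have /andP[h3 h4] := Fadd (blk a) u.
  have h5 : eps / 2 * lam ^+ n <= eps / 2 * word_length (blk a) by rewrite ler_wpM2l //; lra.
  move: hu; rewrite !ler_norml; lra.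
have prefix_bound v u : prefix u (iter n subst_word v) ->
    `|F u - D * word_length u| <= eps * word_length u + K.
  elim: v u => [|a v IH] u.
    rewrite iter_subst_nil prefixs0 => /eqP ->; rewrite {2}/word_length big_nil mulr0 add0r.
    by apply: small; rewrite /word_length big_nil exprn_ge0 // ltW.
  rewrite -[a :: v]cat1s iter_subst_word_cat => /prefix_cat_cases[/prefixW ub|[u' -> pu']].
    exact: small_infix ub.
  by apply: step; apply: IH.
exists n, (K + K + C) => v; elim: v => [|a v IH] u.
  rewrite iter_subst_nil infixs0 -[u == _]prefixs0 => pu; apply: le_trans (prefix_bound [::] u _) _; last lra.
  by rewrite iter_subst_nil.
rewrite -[a :: v]cat1s iter_subst_word_cat => /infix_cat_cases[ub|/IH //|[s [p [-> sb pv]]]].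
  by apply: le_trans (small_infix _ _ ub) _; lra.
have := small_infix a s (suffixW sb); have := prefix_bound _ _ pv.
have /andP[h3 h4] := Fadd s p.
rewrite word_length_cat !mulrDr !ler_norml; lra.
Qed.

End Density.

(** * Patches of elements of the hull *)

Section Patches.
Context {R : realType}.
Implicit Types (x y z r : R) (i j a : 'I_2) (u v : seq 'I_2) (L : set R).
Local Notation lam := (@lambda R).

(** A factor of some [n]-fold substituted word, for every level [n]: all that
    [uniform_density] asks for. *)
Definition legal u : Prop := forall n, exists v, infix u (iter n subst_word v).

Lemma legal_infix u v : infix u v -> legal v -> legal u.
Proof. by move=> uv vl n; have [w /(infix_trans uv)] := vl n; exists w. Qed.

(** The word 00 occurs in the image 0111000 of 0 under the squared
    substitution, so the two halves meeting at the marker occur side by side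
    in the next superword. *)
Lemma legal_superword_pair m : legal (superword m ++ superword m).
Proof.
move=> n; pose M := maxn m.+1 n; exists (iter (M.*2 - n) subst_word [:: 0]).
rewrite -iterD subnKC; last by rewrite -addnn (leq_trans (leq_maxr m.+1 n)) ?leq_addr.
have [t [_ [E _]]] := superword_prefix (leq_maxl m.+1 n).
rewrite -/(superword M) E; apply: infix_catr.
have -> : superword m.+1 =
    iter m.*2 subst_word [:: 0; 1; 1; 1] ++ (superword m ++ superword m) ++ superword m.
  by rewrite /superword doubleS !iterSr -!iter_subst_word_cat.
exact: infix_infix.
Qed.

Lemma mem_tile_starts x u y :
  y \in [seq p.1 | p <- tiles x u] <->
  exists2 k, (k < size u)%N & y = x + word_length (take k u).
Proof.
elim: u x => [|a u IH] x /=; first by split=> // -[].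
rewrite inE; split.
  case/orP => [/eqP ->|/IH[k ku ->]].
    by exists 0%N; rewrite // /word_length take0 big_nil addr0.
  by exists k.+1; rewrite //= word_length_cons addrA.
case=> -[|k] ku yE; apply/orP; [left|right].
  by rewrite yE /word_length big_nil addr0.
by apply/IH; exists k; rewrite // -addrA -word_length_cons.
Qed.

Lemma endpoint_pos m n : (n <= size (superword m))%N ->
  endpoint (Posz n) = word_length (take n (superword m)) :> R.
Proof.
move=> nm; rewrite /endpoint /word_length [RHS](big_nth 0) big_mkord size_takel //=.
apply: eq_bigr => k _; rewrite nth_take //.
by have [<- _] := fixed_wordE (leq_trans (ltn_ord k) nm).
Qed.

Lemma endpoint_neg m n : (n < size (superword m))%N ->
  endpoint (Negz n) = - word_length (take n.+1 (rev (superword m))) :> R.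
Proof.
move=> nm; rewrite /endpoint; congr (- _); rewrite /word_length [RHS](big_nth 0) big_mkord size_takel ?size_rev //=.
apply: eq_bigr => k _; rewrite nth_take //.
by have [_ <-] := fixed_wordE (leq_trans (ltn_ord k) nm).
Qed.

Lemma word_length_rev u : word_length (rev u) = word_length u :> R.
Proof. by rewrite /word_length -(revK u) big_rev revK. Qed.

Lemma word_length_take_drop k u :
  word_length u = word_length (take k u) + word_length (drop k u) :> R.
Proof. by rewrite -word_length_cat cat_take_drop. Qed.

(** Letters beyond the two copies meeting at the marker start outside the
    half-open window. *)
Lemma Lambda_w_window m y : let s := superword m in
  - word_length s <= y < word_length s ->
  Lambda_w y <-> y \in [seq p.1 | p <- tiles (- word_length s) (s ++ s)].
Proof.
move=> s /andP[y1 y2]; have s0 : (0 < size s)%N.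
  exact: leq_ltn_trans (ltn_size_superword m).
have head : - word_length s \in [seq p.1 | p <- tiles (- word_length s : R) (s ++ s)].
  apply/mem_tile_starts; exists 0%N; first by rewrite size_cat addn_gt0 s0.
  by rewrite take0 {3}/word_length big_nil addr0.
have outer n : (size s <= n)%N -> (m <= n)%N.
  by move=> h; apply: leq_trans (ltnW (ltn_size_superword m)) h.
split=> [[[n|n] _ yE]|/mem_tile_starts[k]].
- have [ns|sn] := ltnP n (size s).
    apply/mem_tile_starts; exists (size s + n)%N; first by rewrite size_cat ltn_add2l.
    rewrite take_cat ltnNge leq_addr /= addKn word_length_cat addrA addNr add0r.
    by rewrite -yE (endpoint_pos m) // ltnW.
  have [u [_ [E _]]] := superword_prefix (outer n sn).
  move: y2; rewrite -yE (endpoint_pos n) ?(ltnW (ltn_size_superword n)) // E -/s.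
  rewrite take_cat ltnNge sn /= word_length_cat.
  by have := @word_length_ge0 R (take (n - size s) u); lra.
- have [ns|sn] := ltnP n (size s).
    apply/mem_tile_starts; exists (size s - n.+1)%N; first by rewrite size_cat; lia.
    rewrite -yE (endpoint_neg m) // -/s take_rev word_length_rev.
    rewrite takel_cat ?leq_subr //.
    by have := word_length_take_drop (size s - n.+1) s; lra.
  (* The only remaining candidate in the window is its left end. *)
  have [_ [v [_ E]]] := superword_prefix (outer n sn).
  have hy : endpoint (Negz n) <= - word_length s :> R.
    rewrite (endpoint_neg n) ?ltn_size_superword // E -/s rev_cat take_cat size_rev.
    rewrite ltnNge (leq_trans sn) //= word_length_cat word_length_rev.
    by have := @word_length_ge0 R (take (n.+1 - size s) (rev v)); lra.
  have -> : y = - word_length s by apply/le_anti; rewrite y1 -yE hy.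
  exact: head.
- have [ks _|sk ks] := ltnP k (size s); move=> ->.
    exists (Negz (size s - k.+1)) => //.
    rewrite (endpoint_neg m) -/s ?take_rev ?word_length_rev; last by lia.
    rewrite (_ : size s - (size s - k.+1).+1 = k)%N; last by lia.
    rewrite takel_cat ?(ltnW ks) //.
    by have := word_length_take_drop k s; lra.
  exists (Posz (k - size s)) => //; move: ks; rewrite size_cat => ks.
  rewrite (endpoint_pos m) -/s; last by lia.
  rewrite take_cat ltnNge sk /= word_length_cat; lra.
Qed.

(** Closeness in the local topology with parameter [rho^-1] is an equality on
    the window of radius [rho], and a large superword covers this window
    after translation. *)
Lemma hull_window L (rho : R) : hull L -> 0 < rho ->
  exists x v, [/\ legal v, x <= - rho, rho <= x + word_length v &
    forall y, - rho <= y <= rho -> (L y <-> y \in [seq p.1 | p <- tiles x v])].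
Proof.
move=> hL rho0; have [|t [s _ E]] := hL rho^-1; first by rewrite invr_gt0.
rewrite invrK in E; pose T := s + t.
pose m := (Num.truncn (`|T| + rho)).+1; pose w := superword m.
have Tw : `|T| + rho < word_length w.
  apply: lt_le_trans (truncnS_gt _) _; apply: le_trans (size_le_word_length _).
  by rewrite ler_nat ltnW // ltn_size_superword.
have := ler_norm T; have := ler_norm (- T); rewrite normrN => Tn Tp.
exists (T - word_length w), (w ++ w); split.
- exact: legal_superword_pair.
- lra.
- rewrite word_length_cat; lra.
move=> y yr; have wy : - word_length w <= y - T < word_length w.
  by case/andP: yr; lra.
have -> : L y <-> Lambda_w (y - T).
  have -> : L y <-> (L `&` `[- rho, rho]) y by split=> [|[]//]; split=> //; rewrite /= in_itv.
  rewrite E; split.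
    move=> [[_ [z Lz <-] yE] _]; suff -> : y - T = z by [].
    by rewrite -yE /T; ring.
  move=> h; split; last by rewrite /= in_itv.
  exists (t + (y - T)); last by rewrite /T; ring.
  by exists (y - T).
rewrite (Lambda_w_window m) // -/w tiles_shift -map_comp.
rewrite -[y in X in _ <-> X](addrNK T) [y - T + T]addrC.
by rewrite (map_comp (+%R T) fst) mem_map //; apply: addrI.
Qed.

(** Cut a word at the first tile whose start violates [P]; that start
    overshoots the bound [c] by at most one tile. *)
Lemma tiles_cut (P : pred R) c : (forall y y', y <= y' -> P y' -> P y) ->
  (forall y, P y -> y <= c) -> forall v x, x <= c + lam ->
  exists v1 v2, [/\ v = v1 ++ v2, {in tiles x v1, forall p, P p.1},
    {in tiles (x + word_length v1) v2, forall p, ~~ P p.1},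
    x + word_length v1 <= c + lam & v2 = [::] \/ ~~ P (x + word_length v1)].
Proof.
move=> Pdown Pc; elim=> [|a v IH] x xc.
  by exists [::], [::]; rewrite /word_length big_nil addr0; split=> //; left.
have [Px|Px] := boolP (P x); last first.
  exists [::], (a :: v); rewrite /word_length big_nil addr0; split=> //; last by right.
  by move=> p /tiles_bounds[xp _]; apply: contra Px; apply: Pdown.
have [|v1 [v2 [-> h1 h2 h3 h4]]] := IH (x + tile_length a).
  by have := Pc _ Px; have := @tile_length_bounds R a; lra.
exists (a :: v1), v2; rewrite word_length_cons addrA; split=> //.
by move=> p; rewrite /= inE => /orP[/eqP -> //|/h1].
Qed.

(** The type of a point is decided by the next point on its right, which is
    at distance at most [lam]; a window slightly larger than [[- r, r]]
    therefore determines the types of all points of [[- r, r]]. *)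
Lemma hull_patch L r : hull L -> 0 <= r ->
  exists u x, [/\ legal u, 2 * r - lam <= word_length u,
    forall y, truncation L r y <-> y \in [seq p.1 | p <- tiles x u] &
    forall i y, truncation (points_of_type L i) r y <-> y \in starts i x u].
Proof.
move=> hL r0; have lam2 := @ltr2_lambda R.
(* The extra 1 keeps the successor of a point of [- r, r] away from the
   right end of the patch. *)
have [|x0 [v [vl x0r vr vL]]] := hull_window L (r + lam + 1) hL; first lra.
have [|||v1 [v' [vE c1 c2 c3 _]]] := @tiles_cut (fun y => y < - r) (- r) _ _ v x0.
- by move=> y y'; apply: le_lt_trans.
- by move=> y /ltW.
- lra.
set x := x0 + word_length v1 in c2 c3.
have [|||u [v2 [v'E d1 d2 d3 d4]]] := @tiles_cut (fun y => y <= r) r _ _ v' x.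
- by move=> y y'; apply: le_trans.
- by [].
- lra.
exists u, x.
have inside p : p \in tiles x u -> - r <= p.1 <= r.
  move=> pu; rewrite (d1 p pu) andbT leNgt c2 //.
  by rewrite v'E tiles_cat mem_cat pu.
have mem_patch p : - r <= p.1 <= r -> (p \in tiles x0 v) = (p \in tiles x u).
  move=> /andP[p1 p2]; rewrite vE tiles_cat mem_cat -/x v'E tiles_cat !mem_cat.
  case: (boolP (p \in tiles x0 v1)) => [/c1|_]; first lra.
  case: (boolP (p \in tiles (x + word_length u) v2)) => [/d2|_]; first by rewrite p2.
  by rewrite orbF.
split.
- apply: legal_infix vl; rewrite vE v'E; exact: infix_infix.
- have : r <= x + word_length u.
    case: d4 => [v20|]; last by rewrite -ltNge => /ltW.
    by move: vr; rewrite vE v'E v20 cats0 word_length_cat addrA -/x; lra.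
  lra.
- move=> y; split=> [[Ly]|/mapP[p pu ->]].
    rewrite /= in_itv /= => yr; have : y \in [seq p.1 | p <- tiles x0 v].
      by apply/vL => //; lra.
    by case/mapP => p pv yE; apply/mapP; exists p; rewrite // -mem_patch // -yE.
  have pr := inside p pu; split; last by rewrite /= in_itv.
  apply/vL; first lra.
  by apply: map_f; rewrite mem_patch.
have typed y a i : (y, a) \in tiles x0 v -> - r <= y <= r ->
    points_of_type L i y <-> i = a.
  move=> ya yr; have la := @tile_length_bounds R a.
  have La : points_of_type L a y.
    split.
    - by apply/vL; [lra|exact: (map_f fst ya)].
    - apply/vL; first lra.
      by have [h|//] := tile_successor _ _ _ _ ya; lra.
    - move=> y' Ly' yy'; have [h|h] := leP y' (r + lam + 1); last lra.
      have /mapP[p pv pE] : y' \in [seq p.1 | p <- tiles x0 v] by apply/vL => //; lra.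
      by rewrite pE; apply: (tile_interior _ _ _ _ _ ya) => //; rewrite -pE.
  split=> [[_ L1 L2]|-> //]; case: La => _ L3 L4.
  have li := @tile_length_bounds R i.
  apply: (@tile_length_inj R); apply/le_anti.
  have := L2 _ L3; have := L4 _ L1; rewrite !lerD2l => h1 h2.
  by rewrite h1 ?h2 //; lra.
move=> i y; rewrite mem_starts; split=> [[Ly]|yu].
  rewrite /= in_itv /= => yr; have : y \in [seq p.1 | p <- tiles x0 v].
    by apply/vL; [lra|case: Ly].
  case/mapP => -[y' a] pv /= yE; rewrite -{y'}yE in pv.
  by rewrite -mem_patch //; move/(typed _ _ i pv yr): Ly => ->.
have yr := inside _ yu; split; last by rewrite /= in_itv.
by apply/(typed _ i) => //; rewrite mem_patch.
Qed.

Lemma card_seq (s : seq R) : uniq s -> Defs.card [set` s] = size s.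
Proof.
move=> us; rewrite /Defs.card.
have -> : fset_set [set` s] = [fset x in s]%fset.
  apply/fsetP => x; rewrite in_fset_set ?in_fset; last exact: finite_seq.
  by apply/idP/idP => [/set_mem|?]; [|apply/mem_set].
by rewrite card_fseq undup_id.
Qed.

Lemma pair_ratio_patch L i j z r x u :
  (forall y, truncation L r y <-> y \in [seq p.1 | p <- tiles x u]) ->
  (forall i y, truncation (points_of_type L i) r y <-> y \in starts i x u) ->
  pair_ratio L i j z r = (paircount i j z u)%:R / (size u)%:R.
Proof.
move=> hL ht; rewrite /pair_ratio; congr (_%:R / _%:R).
  have -> : truncation (points_of_type L i) r `&`
      [set y - z | y in truncation (points_of_type L j) r] =
      [set` [seq y <- starts i x u | y + z \in starts j x u]].
    apply/seteqP; split=> y /=; rewrite mem_filter.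
      by case=> /ht -> [y' /ht hy' <-]; rewrite subrK hy'.
    case/andP => h1 h2; split; first exact/ht.
    by exists (y + z); [exact/ht|rewrite addrK].
  rewrite card_seq ?filter_uniq ?uniq_starts // size_filter.
  by rewrite -(paircountE i j z x) pairs_atE ?uniq_starts.
have -> : truncation L r = [set` [seq p.1 | p <- tiles x u]].
  by apply/seteqP; split=> y /hL.
by rewrite card_seq ?uniq_tile_starts // size_map size_tiles.
Qed.

End Patches.

(** * Correlations as quotients of densities *)

Section Correlations.
Context {R : realType}.
Implicit Types (z r : R) (i j : 'I_2) (u v : seq 'I_2) (L : set R).
Local Notation lam := (@lambda R).

(** Uniformity is what lets the word vary arbitrarily with [r]. *)
Lemma patch_density_cvg (C : R) (F : seq 'I_2 -> R) (U : R -> seq 'I_2) : almost_additive C F ->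
  (forall r, 0 <= r -> legal (U r) /\ 2 * r - lam <= word_length (U r)) ->
  F (U r) / word_length (U r) @[r --> +oo] --> limn (scaled_count F).
Proof.
move=> FC HU; apply/cvgrPdist_le => eps eps0.
have [|n [K hK]] := uniform_density C F (eps / 2) FC; first by rewrite divr_gt0.
have lam2 := @ltr2_lambda R; pose r0 := Num.max lam (2 * K / eps).
near=> r; have r0r : r0 <= r by near: r; apply: nbhs_pinfty_ge; exact: num_real.
move: r0r; rewrite /r0 ge_max => /andP[lr Kr].
have [|legU lenU] := HU r; first lra.
have [v uv] := legU n; have := hK v _ uv.
have W0 : (0 : R) < word_length (U r) by lra.
have KW : K <= eps / 2 * word_length (U r).
  rewrite ler_pdivrMr // in Kr; have : eps * r <= eps * word_length (U r) by rewrite ler_pM2l //; lra.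
  lra.
move: (limn _) (word_length _) (F _) W0 KW => D W f W0 KW h.
have -> : D - f / W = - ((f - D * W) / W) by field; rewrite gt_eqF.
rewrite normrN normrM (gtr0_norm (_ : 0 < W^-1)) ?invr_gt0 // ler_pdivrMr //; lra.
Unshelve. all: by end_near. Qed.

Definition pair_density i j z : R :=
  limn (scaled_count (fun u => (@paircount R i j z u)%:R)).

Lemma almost_additive_paircount i j z :
  almost_additive `|z| (fun u => (@paircount R i j z u)%:R).
Proof.
split=> [u|u v]; first by rewrite ler0n paircount_le_length.
by have [-> ->] := paircount_cat i j z u v.
Qed.

Lemma pair_density_cvg i j z :
  scaled_count (fun u => (@paircount R i j z u)%:R) @ \oo --> pair_density i j z.
Proof. exact: scaled_count_cvg _ _ (almost_additive_paircount i j z). Qed.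

(** Tiles have length at most [lam], so there are at least [1 / lam] of them
    per unit length. *)
Lemma point_density_gt0 : 0 < pair_density 0 0 0 + pair_density 1 1 0.
Proof.
have lam0 := @lambda_gt0 R.
have cv : scaled_count (fun u => (@paircount R 0 0 0 u)%:R) n
    + scaled_count (fun u => (@paircount R 1 1 0 u)%:R) n @[n --> \oo]
    --> pair_density 0 0 0 + pair_density 1 1 0.
  exact: cvgD (pair_density_cvg 0 0 0) (pair_density_cvg 1 1 0).
apply: (@lt_le_trans _ _ lam^-1); first by rewrite invr_gt0.
apply: (cvgr_to_ge cv).
near=> n; rewrite /scaled_count /= -mulrDl -natrD -size_paircount.
set w := iter n _ _; have wE : word_length w = lam ^+ n.+1.
  by rewrite word_length_iter /word_length big_seq1 /tile_length /= exprSr.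
rewrite ler_pdivlMr ?exprn_gt0 // -wE mulrC ler_pdivrMr // mulrC.
exact: word_length_le_size.
Unshelve. all: by end_near. Qed.

Definition pair_frequency i j z : R :=
  pair_density i j z / (pair_density 0 0 0 + pair_density 1 1 0).

(** Divide numerator and denominator by the length of the patch of
    [hull_patch]; the limit does not involve [L]. *)
Lemma pair_ratio_cvg L i j z : hull L ->
  pair_ratio L i j z r @[r --> +oo] --> pair_frequency i j z.
Proof.
move=> hL; have lam2 := @ltr2_lambda R.
have /choice[U HU] : forall r, exists u, 0 <= r ->
    [/\ legal u, 2 * r - lam <= word_length u &
      forall i j z, pair_ratio L i j z r = (paircount i j z u)%:R / (size u)%:R].
  move=> r; have [r0|] := leP 0 r; last by exists [::].
  have [u [x [h1 h2 h3 h4]]] := hull_patch L r hL r0.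
  by exists u => _; split=> // ? ? ?; apply: pair_ratio_patch h3 h4.
have dens i' j' z' : (paircount i' j' z' (U r))%:R / word_length (U r) @[r --> +oo]
    --> pair_density i' j' z'.
  apply: patch_density_cvg (almost_additive_paircount i' j' z') _ => r r0.
  by have [] := HU r r0.
apply: cvg_trans (cvgM (dens i j z) (cvgV (lt0r_neq0 point_density_gt0)
  (cvgD (dens 0 0 0) (dens 1 1 0)))).
apply: near_eq_cvg.
near=> r; have lr : lam <= r by near: r; apply: nbhs_pinfty_ge; exact: num_real.
have [|_ lenU ->] := HU r; first lra.
have W0 : word_length (U r) != 0 :> R by rewrite gt_eqF //; lra.
by rewrite /= addrfctE -mulrDl -natrD -size_paircount invf_div mulrA divfK.
Unshelve. all: by end_near. Qed.

Lemma pair_corrE L i j z : hull L -> pair_corr L i j z = pair_frequency i j z.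
Proof. by move=> hL; apply/cvg_lim => //; apply: pair_ratio_cvg. Qed.

End Correlations.

(** * Renormalisation of densities *)

Section Transfer.
Context {R : realType}.
Implicit Types (z : R) (i j : 'I_2).
Local Notation lam := (@lambda R).

(** Counting in the substituted word is counting one level further, while
    still dividing by the length of the original word. *)
Lemma scaled_count_subst_cvg (F : seq 'I_2 -> R) l :
  scaled_count F @ \oo --> l ->
  scaled_count (fun u => F (subst_word u)) @ \oo --> lam * l.
Proof.
move=> cv; have -> : scaled_count (fun u => F (subst_word u)) =
    (fun n => lam * scaled_count F n.+1).
  apply/funext => n; rewrite /scaled_count -iterS [in RHS]exprS.
  by have := gt_eqF (@lambda_gt0 R) => /negbT l0; field; rewrite expf_neq0 //= l0.
by apply: cvgMr; rewrite (cvg_shiftS (scaled_count F)).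
Qed.

Lemma scaled_countD (F G : seq 'I_2 -> R) :
  scaled_count (fun u => F u + G u) = scaled_count F \+ scaled_count G.
Proof. by apply/funext => n; rewrite /scaled_count mulrDl. Qed.

Lemma pair_density_substE i j z (l : R) (F : seq 'I_2 -> R) :
  (forall u, (paircount i j z (subst_word u))%:R = F u) ->
  scaled_count F @ \oo --> l -> pair_density i j z = lam^-1 * l.
Proof.
move=> E cv; have lam0 : lam != 0 by rewrite gt_eqF // lambda_gt0.
have := scaled_count_subst_cvg _ _ (pair_density_cvg i j z).
have -> : (fun u => (paircount i j z (subst_word u))%:R) = F by apply/funext.
by move/(cvg_unique _ cv) => ->; rewrite // mulKf.
Qed.

Lemma scaled_countD_cvg (F G : seq 'I_2 -> R) l m :
  scaled_count F @ \oo --> l -> scaled_count G @ \oo --> m ->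
  scaled_count (fun u => F u + G u) @ \oo --> l + m.
Proof. by move=> cF cG; rewrite scaled_countD; apply: cvgD. Qed.

Lemma scaled_countM_cvg c (F : seq 'I_2 -> R) l :
  scaled_count F @ \oo --> l -> scaled_count (fun u => c * F u) @ \oo --> c * l.
Proof.
move=> cF; have -> : scaled_count (fun u => c * F u) = (fun n => c * scaled_count F n).
  by apply/funext => n; rewrite /scaled_count mulrA.
exact: cvgMr.
Qed.

Lemma scaled_count_sum_cvg (s : seq nat) (F : nat -> seq 'I_2 -> R) (l : nat -> R) :
  (forall m, scaled_count (F m) @ \oo --> l m) ->
  scaled_count (fun u => \sum_(m <- s) F m u) @ \oo --> \sum_(m <- s) l m.
Proof.
move=> cF; elim: s => [|m s IH].
  rewrite big_nil (_ : scaled_count _ = fun=> 0); first exact: cvg_cst.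
  by apply/funext => n; rewrite /scaled_count big_nil mul0r.
rewrite big_cons (_ : (fun u => _) = fun u => F m u + \sum_(k <- s) F k u).
  exact: scaled_countD_cvg.
by apply/funext => u; rewrite big_cons.
Qed.

Lemma pair_density_renormalisation z :
  [/\ pair_density 0 0 z = lam^-1 * (pair_density 0 0 (z / lam) + pair_density 0 1 (z / lam)
                              + pair_density 1 0 (z / lam) + pair_density 1 1 (z / lam)),
         pair_density 0 1 z = lam^-1 * \sum_(0 <= m < 3)
                      (pair_density 0 0 ((z - m%:R - lam) / lam)
                       + pair_density 1 0 ((z - m%:R - lam) / lam)),
         pair_density 1 0 z = lam^-1 * \sum_(0 <= m < 3)
                      (pair_density 0 0 ((z + m%:R + lam) / lam)
                       + pair_density 0 1 ((z + m%:R + lam) / lam)) &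
         pair_density 1 1 z = lam^-1 * (3 * pair_density 0 0 (z / lam)
                              + 2 * pair_density 0 0 ((z + 1) / lam)
                              + 2 * pair_density 0 0 ((z - 1) / lam)
                              + pair_density 0 0 ((z + 2) / lam)
                              + pair_density 0 0 ((z - 2) / lam))].
Proof.
split.
- apply: (pair_density_substE _ _ _ _ (fun u => (paircount 0 0 (z / lam) u)%:R
      + (paircount 0 1 (z / lam) u)%:R + (paircount 1 0 (z / lam) u)%:R
      + (paircount 1 1 (z / lam) u)%:R)) => [u|].
    by rewrite paircount00_subst !natrD.
  by repeat apply: scaled_countD_cvg; exact: pair_density_cvg.
- apply: (pair_density_substE _ _ _ _ (fun u => \sum_(0 <= m < 3)
      ((paircount 0 0 ((z - m%:R - lam) / lam) u)%:R
       + (paircount 1 0 ((z - m%:R - lam) / lam) u)%:R))) => [u|].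
    by rewrite paircount01_subst natr_sum; apply: eq_bigr => m _; rewrite natrD.
  by apply: scaled_count_sum_cvg => m; apply: scaled_countD_cvg; exact: pair_density_cvg.
- apply: (pair_density_substE _ _ _ _ (fun u => \sum_(0 <= m < 3)
      ((paircount 0 0 ((z + m%:R + lam) / lam) u)%:R
       + (paircount 0 1 ((z + m%:R + lam) / lam) u)%:R))) => [u|].
    by rewrite paircount10_subst natr_sum; apply: eq_bigr => m _; rewrite natrD.
  by apply: scaled_count_sum_cvg => m; apply: scaled_countD_cvg; exact: pair_density_cvg.
- apply: (pair_density_substE _ _ _ _ (fun u => 3 * (paircount 0 0 (z / lam) u)%:R
      + 2 * (paircount 0 0 ((z + 1) / lam) u)%:R + 2 * (paircount 0 0 ((z - 1) / lam) u)%:R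
      + (paircount 0 0 ((z + 2) / lam) u)%:R + (paircount 0 0 ((z - 2) / lam) u)%:R)) => [u|].
    by rewrite paircount11_subst; ring.
  by repeat apply: scaled_countD_cvg; try apply: scaled_countM_cvg; exact: pair_density_cvg.
Qed.

End Transfer.

Theorem proposition3p2 (R : realType) (L : set R) (hL : hull L) :
  let lam : R := lambda in
  let nu : 'I_2 -> 'I_2 -> R -> R := pair_corr L in
  (* nu is well defined and is the same for all elements of the hull *)
  (forall L' : set R, hull L' -> forall (i j : 'I_2) (z : R),
     pair_ratio L' i j z r @[r --> +oo] --> nu i j z) /\
  (forall z : R,
     [/\ nu 0 0 z = lam^-1 * (nu 0 0 (z / lam) + nu 0 1 (z / lam)
                              + nu 1 0 (z / lam) + nu 1 1 (z / lam)),
         nu 0 1 z = lam^-1 * \sum_(0 <= m < 3)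
                      (nu 0 0 ((z - m%:R - lam) / lam)
                       + nu 1 0 ((z - m%:R - lam) / lam)),
         nu 1 0 z = lam^-1 * \sum_(0 <= m < 3)
                      (nu 0 0 ((z + m%:R + lam) / lam)
                       + nu 0 1 ((z + m%:R + lam) / lam)) &
         nu 1 1 z = lam^-1 * (3 * nu 0 0 (z / lam)
                              + 2 * nu 0 0 ((z + 1) / lam)
                              + 2 * nu 0 0 ((z - 1) / lam)
                              + nu 0 0 ((z + 2) / lam)
                              + nu 0 0 ((z - 2) / lam))]) /\
  (forall (i j : 'I_2) (z : R), ~ difference_set L i j z -> nu i j z = 0) /\
  (forall (i j : 'I_2) (z : R), nu j i z = nu i j (- z)).
Proof.
move=> lam nu.
have nuE i j z : nu i j z = pair_frequency i j z by apply: pair_corrE.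
split; first by move=> L' hL' i j z; rewrite nuE; apply: pair_ratio_cvg.
split.
  move=> z; rewrite !nuE /pair_frequency /lam.
  have [E00 E01 E10 E11] := pair_density_renormalisation z; split.
  - by rewrite E00 -!mulrDl mulrA.
  - rewrite E01 -mulrA mulr_suml; congr (_ * _); apply: eq_bigr => m _.
    by rewrite !nuE -mulrDl.
  - rewrite E10 -mulrA mulr_suml; congr (_ * _); apply: eq_bigr => m _.
    by rewrite !nuE -mulrDl.
  - by rewrite E11 !(mulrA _ (pair_density _ _ _)) -!mulrDl mulrA.
split.
  move=> i j z hz; apply/cvg_lim => //.
  suff -> : pair_ratio L i j z = fun=> 0 by apply: cvg_cst.
  apply/funext => r; rewrite /pair_ratio.
  suff -> : truncation (points_of_type L i) r `&`
      [set y - z | y in truncation (points_of_type L j) r] = set0.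
    by rewrite /Defs.card fset_set0 cardfs0 mul0r.
  apply/seteqP; split=> // x [[xi _]] [y [yj _] yx]; apply: hz.
  by exists y => //; exists x => //; rewrite -yx subKr.
move=> i j z; rewrite !nuE /pair_frequency; congr (_ / _).
rewrite /pair_density; congr (limn (scaled_count _)).
by apply/funext => u; rewrite paircount_sym.
Qed.
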